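(* Let $f_{-2}:\mathbb{R}\to\mathbb{R}$, $f_{-2}(x)=x^2-2$. Then the non-wandering set $\mathcal{NW}(f_{-2})$ is not hyperbolic (for $f_{-2}$).
   Context: Here $\mathbb{N}=\{1,2,3,\dots\}$, and $f^{n}$ denotes the $n$-fold composition of $f$ with itself. Non-wandering set: for a continuous map $f:\mathbb{R}\to\mathbb{R}$, $\mathcal{NW}(f):=\{x\in\mathbb{R} : \text{for every neighbourhood } U \text{ of } x \text{ there is } n\in\mathbb{N} \text{ with } f^{n}(U)\cap U\neq\emptyset\}$. Hyperbolicity: let $f:\mathbb{R}\to\mathbb{R}$ be smooth and let $M\subset\mathbb{R}$ be an $f$-invariant set, meaning $f(M)\subset M$. For $x\in M$ the tangent space at $x$ is taken to be $T_x=T_x\mathbb{R}=\mathbb{R}$, and $D_xf: T_x\to T_{f(x)}$ is multiplication by $f'(x)$. The set $M$ is called hyperbolic if there exist constants $K,C>0$ and $\Lambda>1$ such that, with $$E_x^s:=\{v\in T_x : |(D_xf^{n})v|\le K\Lambda^{-n}|v| \text{ for all } n\in\mathbb{N}\},\qquad E_x^u:=\{v\in T_x : |(D_xf^{n})v|\ge C\Lambda^{n}|v| \text{ for all } n\in\mathbb{N}\},$$ for every $x\in M$ one has $T_x=E_x^s\oplus E_x^u$, $D_xf(E_x^s)=E_{f(x)}^s$ and $D_xf(E_x^u)=E_{f(x)}^u$. *)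

(* Defs.v *)
From HB Require Import structures.
From mathcomp Require Import all_boot all_order all_algebra.
From mathcomp Require Import all_classical all_reals all_analysis.

Set Implicit Arguments.
Unset Strict Implicit.
Unset Printing Implicit Defensive.

Import Order.TTheory GRing.Theory Num.Theory.
Import numFieldNormedType.Exports.

Local Open Scope ring_scope.
Local Open Scope classical_set_scope.

Definition nonwandering (R : realType) (f : R -> R) : set R :=
  [set x | forall U : set R, nbhs x U ->
     exists2 n : nat, (0 < n)%N & (iter n f @` U) `&` U !=set0].

Definition invariant_set (R : realType) (f : R -> R) (M : set R) : Prop :=
  f @` M `<=` M.

Definition smooth (R : realType) (f : R -> R) : Prop :=
  forall (k : nat) (x : R), derivable f^`(k) x 1.

(* D_x f, with every tangent space T_x R identified with R. *)
Definition tangent_map (R : realType) (f : R -> R) (x : R) : R -> R :=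
  fun v => (f^`() x)%classic * v.

Definition stable_space (R : realType) (f : R -> R) (K L x : R) : set R :=
  [set v | forall n : nat, (0 < n)%N ->
     `|tangent_map (iter n f) x v| <= K * L ^- n * `|v|].

Definition unstable_space (R : realType) (f : R -> R) (C L x : R) : set R :=
  [set v | forall n : nat, (0 < n)%N ->
     `|tangent_map (iter n f) x v| >= C * L ^+ n * `|v|].

(* R is the internal direct sum of A and B.  This is only meaningful for linear
   subspaces; see stable_space_linear and unstable_space_linear below. *)
Definition direct_sum (R : realType) (A B : set R) : Prop :=
  [set a + b | a in A & b in B] = setT /\ A `&` B = [set 0].

(* The notion is meant for smooth f and f-invariant M.  These are standing
   assumptions rather than part of the property, so that a set is not declared
   non-hyperbolic merely because one of them fails; see smooth_f_m2 and
   nonwandering_invariant. *)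
Definition hyperbolic (R : realType) (f : R -> R) (M : set R) : Prop :=
  exists K C L : R, [/\ 0 < K, 0 < C, 1 < L &
    forall x, M x ->
      [/\ direct_sum (stable_space f K L x) (unstable_space f C L x),
          tangent_map f x @` stable_space f K L x = stable_space f K L (f x) &
          tangent_map f x @` unstable_space f C L x
            = unstable_space f C L (f x)]].

Definition f_m2 (R : realType) : R -> R := fun x => x ^+ 2 - 2.

Definition linear_subspace (R : realType) (A : set R) : Prop :=
  A 0 /\ forall a u v : R, A u -> A v -> A (a * u + v).

Lemma stable_space_linear (R : realType) (f : R -> R) (K L x : R) :
  linear_subspace (stable_space f K L x).
Proof.
split=> [n _|a u v Au Av n n0].
  by rewrite /tangent_map mulr0 !normr0 mulr0.
suff [w0|[w w0 /(_ n n0)]] :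
    a * u + v = 0 \/ exists2 w, w != 0 & stable_space f K L x w.
- by rewrite w0 /tangent_map mulr0 !normr0 mulr0.
- by rewrite /tangent_map !normrM ler_pM2r ?normr_gt0// => /ler_wpM2r; apply.
have [u0|u0] := eqVneq u 0; last by right; exists u.
have [v0|v0] := eqVneq v 0; last by right; exists v.
by left; rewrite u0 v0 mulr0 addr0.
Qed.

Lemma unstable_space_linear (R : realType) (f : R -> R) (C L x : R) :
  linear_subspace (unstable_space f C L x).
Proof.
split=> [n _|a u v Au Av n n0].
  by rewrite /tangent_map mulr0 !normr0 mulr0.
suff [w0|[w w0 /(_ n n0)]] :
    a * u + v = 0 \/ exists2 w, w != 0 & unstable_space f C L x w.
- by rewrite w0 /tangent_map mulr0 !normr0 mulr0.
- by rewrite /tangent_map !normrM ler_pM2r ?normr_gt0// => /ler_wpM2r; apply.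
have [u0|u0] := eqVneq u 0; last by right; exists u.
have [v0|v0] := eqVneq v 0; last by right; exists v.
by left; rewrite u0 v0 mulr0 addr0.
Qed.

Lemma nonwandering_invariant (R : realType) (f : R -> R) :
  continuous f -> invariant_set f (nonwandering f).
Proof.
move=> cf _ [x NWx <-] U Ufx.
have [n n0 [_ [[y Uy <-] Ufny]]] := NWx _ (cf x _ Ufx).
exists n => //; exists (f (iter n f y)); split=> //.
by exists (f y); rewrite -?iterSr.
Qed.

Lemma smooth_f_m2 (R : realType) : smooth (@f_m2 R).
Proof.
have d0 : (@f_m2 R)^`() = fun x => 2 * x.
  apply/funext => x; rewrite derive1E /f_m2 deriveB// derive_cst subr0.
  by rewrite exp_derive expr1 scaler_nat /GRing.scale/= mulr1 mulr_natl.
have d1 : (fun x : R => 2 * x)^`() = cst 2.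
  apply/funext => x; rewrite derive1E deriveM// derive_id derive_cst.
  by rewrite /GRing.scale/= mulr0 addr0 mulr1.
have d2 (c : R) : (cst c : R -> R)^`() = cst 0.
  by apply/funext => x; rewrite derive1E derive_cst.
have dk k : (@f_m2 R)^`(k.+2) = cst (if k is 0 then 2 else 0).
  by elim: k => [|k IH]; rewrite derive1nS ?IH ?d2// derive1nS derive1n0 d0 d1.
move=> [|[|k]] x.
- by rewrite derive1n0 /f_m2; apply: derivableB.
- by rewrite derive1nS derive1n0 d0; apply: derivableM.
- by rewrite dk.
Qed.

(* Main.v *)
Require Import Defs.
From mathcomp Require Import all_boot all_order all_algebra.
From mathcomp Require Import all_classical all_reals all_analysis.
From mathcomp Require Import ring.

Import Order.TTheory GRing.Theory Num.Theory.
Import numFieldNormedType.Exports.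

Local Open Scope ring_scope.
Local Open Scope classical_set_scope.

(** The critical point [0] of [x ^ 2 - 2] is non-wandering, and an invariant
    hyperbolic set cannot contain a critical point.

    The second fact ([hyperbolic_derive1_neq0]) is a dimension count: if
    [f' x = 0], then [D_x f] kills both the stable and the unstable space at
    [x], so equivariance makes both spaces at [f x] trivial, and they cannot
    span the tangent line there.

    The first fact ([nonwandering_f_m2_0]) comes from the semiconjugacy
    [f (2 cos t) = 2 cos (2 t)] with the doubling map: the points
    [2 sin (pi / 2 ^ n.+1)] tend to [0], and the [n]-th iterate sends
    each of them, for [n > 0], exactly to [0]. *)

(** * Critical points and hyperbolicity *)

Lemma tangent_map_image0 {R : realType} {f : R -> R} {x : R} {E E' : set R} :
  f^`() x = 0 -> tangent_map f x @` E = E' -> E' `<=` [set 0].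
Proof. by move=> f'0 <- _ [v _ <-]; rewrite /tangent_map f'0 mul0r. Qed.

Lemma hyperbolic_derive1_neq0 {R : realType} {f : R -> R} {M : set R} {x : R} :
  hyperbolic f M -> M x -> M (f x) -> f^`() x != 0.
Proof.
move=> [K [C [L [_ _ _ hM]]]] Mx Mfx; apply/eqP => f'0.
have [_ fs fu] := hM _ Mx; have [[spanT _] _ _] := hM _ Mfx.
have : [set: R] 1 by [].
rewrite -spanT => -[a /(tangent_map_image0 f'0 fs) -> [b]].
move=> /(tangent_map_image0 f'0 fu) -> /esym/eqP.
by rewrite addr0 oner_eq0.
Qed.

(** * Recurrence near the critical point *)

Lemma continuous_f_m2 (R : realType) : continuous (@f_m2 R).
Proof.
move=> x; apply/differentiable_continuous/derivable1_diffP.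
by have := @smooth_f_m2 R 0%N x; rewrite derive1n0.
Qed.

Lemma derive1_f_m2_0 (R : realType) : (@f_m2 R)^`() 0 = 0.
Proof.
rewrite derive1E /f_m2 deriveB// derive_cst subr0.
by rewrite exp_derive expr1 scaler0 scale0r.
Qed.

(** The double-angle formula makes [2 cos] a semiconjugacy from angle doubling. *)
Lemma iter_f_m2_cos (R : realType) (n : nat) (t : R) :
  iter n (@f_m2 R) (2 * cos t) = 2 * cos (t *+ 2 ^ n).
Proof.
elim: n => [|n IH]; first by rewrite expn0 mulr1n.
by rewrite iterS IH expnSr mulrnA cos_mulr2n /f_m2; ring.
Qed.

Lemma sin_pi_mulrn (R : realType) (n : nat) : sin (pi *+ n) = 0 :> R.
Proof.
by elim: n => [|n IH]; rewrite ?mulr0n ?sin0// mulrSr sinDpi IH oppr0.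
Qed.

Lemma iter_f_m2_sin (R : realType) (n : nat) :
  iter n.+1 (@f_m2 R) (2 * sin (geometric (pi / 2) 2^-1 n.+1)) = 0.
Proof.
(* Multiplied by 2 ^ n.+1, the angle pi / 2 ^ n.+2 - pi / 2 becomes
   pi / 2 - 2 ^ n pi, a zero of cos. *)
rewrite -cosBpihalf iter_f_m2_cos.
have -> : (geometric (pi / 2) 2^-1 n.+1 - pi / 2) *+ 2 ^ n.+1
    = - (pi *+ 2 ^ n - pi / 2) :> R.
  rewrite /geometric /= -[LHS]mulr_natr -[pi *+ _]mulr_natr !natrX exprVn exprS.
  by field; rewrite expf_neq0.
by rewrite cosN cosBpihalf sin_pi_mulrn mulr0.
Qed.

Lemma nonwandering_f_m2_0 (R : realType) : nonwandering (@f_m2 R) 0.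
Proof.
move=> U U0.
have half_lt1 : `|2^-1 : R| < 1.
  by rewrite ger0_norm ?invr_ge0// invf_lt1// ltr1n.
have sin_cvg : 2 * sin (geometric (pi / 2) 2^-1 n) @[n --> \oo] --> (0 : R).
  have <- : 2 * sin 0 = 0 :> R by rewrite sin0 mulr0.
  apply: cvgMl_tmp; apply: continuous_cvg; first exact: continuous_sin.
  exact: cvg_geometric.
have [N _ UN] := sin_cvg _ U0.
exists N.+1 => //; exists 0; split; last exact: nbhs_singleton.
by exists (2 * sin (geometric (pi / 2) 2^-1 N.+1));
  [apply: UN => /= | exact: iter_f_m2_sin].
Qed.

Theorem mainTheorem1 (R : realType) :
  ~ hyperbolic (@f_m2 R) (nonwandering (@f_m2 R)).
Proof.
have NW0 := @nonwandering_f_m2_0 R.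
have NWf0 : nonwandering (@f_m2 R) (f_m2 0).
  by apply: (nonwandering_invariant (@continuous_f_m2 R)); exists 0.
move=> /hyperbolic_derive1_neq0 /(_ NW0 NWf0) /eqP; apply.
exact: derive1_f_m2_0.
Qed.
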